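(* The elements $$X^i Y^j Z^k \kappa^r \lambda^s \mu^t\qquad\text{for all } i,j,k,r,s,t\in\mathbb N$$ form an $\mathbb F$-basis for $\mathfrak{BI}$.
   Context: $\mathbb F$ is a field with $\operatorname{char}\mathbb F\neq 2$; $\mathbb N$ is the set of nonnegative integers. Algebras are associative with unit $1$. $\{a,b\}=ab+ba$. The Bannai--Ito algebra $\mathfrak{BI}$ is the $\mathbb F$-algebra defined by generators $X,Y,Z$ and the relations asserting that each of $\kappa=\{X,Y\}-Z$, $\lambda=\{Y,Z\}-X$, $\mu=\{Z,X\}-Y$ is central in $\mathfrak{BI}$. *)

(* Defs.v *)
From HB Require Import structures.
From mathcomp Require Import all_boot all_algebra.
From mathcomp Require Import boolp.
From mathcomp Require Import finmap.
From mathcomp Require Import monalg.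

Set Implicit Arguments.
Unset Strict Implicit.
Unset Printing Implicit Defensive.

Import GRing.Theory.

Local Open Scope ring_scope.
Local Open Scope quotient_scope.

(* A possibly infinite family e is a basis when it spans (with finite
   combinations) and is linearly independent; independence of a family entails
   that its members are pairwise distinct. *)
Definition spanning (F : fieldType) (V : lmodType F) (I : eqType)
    (e : I -> V) : Prop :=
  forall v : V, exists (s : seq I) (c : I -> F), v = \sum_(i <- s) c i *: e i.

Definition lin_independent (F : fieldType) (V : lmodType F) (I : eqType)
    (e : I -> V) : Prop :=
  forall (s : seq I) (c : I -> F), uniq s ->
    \sum_(i <- s) c i *: e i = 0 -> forall i, i \in s -> c i = 0.

Definition is_basis (F : fieldType) (V : lmodType F) (I : eqType)
    (e : I -> V) : Prop :=
  spanning e /\ lin_independent e.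

Definition anticomm (A : pzRingType) (a b : A) : A := a * b + b * a.

Definition comm_br (A : pzRingType) (a b : A) : A := a * b - b * a.

Definition central (A : pzRingType) (c : A) : Prop := forall a, c * a = a * c.

(* The expressions kappa, lambda, mu in three elements of any ring. *)
Definition bi_kappa (A : pzRingType) (x y z : A) : A := anticomm x y - z.
Definition bi_lambda (A : pzRingType) (x y z : A) : A := anticomm y z - x.
Definition bi_mu (A : pzRingType) (x y z : A) : A := anticomm z x - y.

Section RMorphism.
Variables (A B : pzRingType) (f : {rmorphism A -> B}).

Lemma rmorph_comm_br a b : f (comm_br a b) = comm_br (f a) (f b).
Proof. by rewrite /comm_br rmorphB !rmorphM. Qed.

Lemma rmorph_anticomm a b : f (anticomm a b) = anticomm (f a) (f b).
Proof. by rewrite /anticomm rmorphD !rmorphM. Qed.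

Lemma rmorph_bi_kappa x y z : f (bi_kappa x y z) = bi_kappa (f x) (f y) (f z).
Proof. by rewrite /bi_kappa rmorphB rmorph_anticomm. Qed.

Lemma rmorph_bi_lambda x y z :
  f (bi_lambda x y z) = bi_lambda (f x) (f y) (f z).
Proof. by rewrite /bi_lambda rmorphB rmorph_anticomm. Qed.

Lemma rmorph_bi_mu x y z : f (bi_mu x y z) = bi_mu (f x) (f y) (f z).
Proof. by rewrite /bi_mu rmorphB rmorph_anticomm. Qed.

End RMorphism.

Lemma malg_scalerAr (F : comNzRingType) (M : monomType) (k : F)
    (x y : {malg F[M]}) : k *: (x * y) = x * (k *: y).
Proof.
rewrite -[k *: (x * y)]mul_malgC -[k *: y]mul_malgC [LHS]mulrA [RHS]mulrA.
congr (_ * _); rewrite !malgM_def fgmulUg fgmulgU.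
by apply: eq_bigr => m _; rewrite mulrC mul1m mulm1.
Qed.

Section FreeAlgebra.
Variables (F : comNzRingType) (I : choiceType).

(* The free algebra is the monoid algebra of the free monoid. The library
   gives it an lalgType structure only: scalerAr is missing. *)
Definition free_alg : Type := {malg F[{fmonom I}]}.

HB.instance Definition _ := GRing.Lalgebra.on free_alg.

Lemma free_alg_scalerAr (k : F) (x y : free_alg) :
  k *: (x * y) = x * (k *: y).
Proof. exact: malg_scalerAr. Qed.

HB.instance Definition _ :=
  GRing.Lalgebra_isAlgebra.Build F free_alg free_alg_scalerAr.

(* Locked so that unification does not unfold monoid-algebra terms. *)
Fact free_gen_key : unit. Proof. by []. Qed.

Definition free_gen (i : I) : free_alg :=
  locked_with free_gen_key (<< fmu i >> : free_alg).

Lemma free_genE i : free_gen i = << fmu i >>.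
Proof. exact: locked_withE. Qed.

End FreeAlgebra.

Section PresentedAlgebra.
Variables (F : comNzRingType) (A : algType F) (S : A -> Prop).

Inductive two_sided_ideal : A -> Prop :=
| Ideal_gen p : S p -> two_sided_ideal p
| Ideal_0 : two_sided_ideal 0
| Ideal_add p q :
    two_sided_ideal p -> two_sided_ideal q -> two_sided_ideal (p + q)
| Ideal_mull a p : two_sided_ideal p -> two_sided_ideal (a * p)
| Ideal_mulr a p : two_sided_ideal p -> two_sided_ideal (p * a).

Definition ideal_pred : A -> bool := fun p => `[< two_sided_ideal p >].

Lemma ideal_predP p : reflect (two_sided_ideal p) (p \in ideal_pred).
Proof. exact: asboolP. Qed.

Lemma ideal_pred_zmod_closed : zmod_closed ideal_pred.
Proof.
split=> [|x y]; first by apply/ideal_predP; exact: Ideal_0.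
move=> /ideal_predP Ix /ideal_predP Iy; apply/ideal_predP.
by apply: Ideal_add => //; rewrite -mulN1r; exact: Ideal_mull.
Qed.

HB.instance Definition _ :=
  GRing.isZmodClosed.Build A ideal_pred ideal_pred_zmod_closed.

Definition ideal_closed : zmodClosed A :=
  GRing.ZmodClosed.clone A ideal_pred _.

Definition alg_quot : Type := Quotient.quot ideal_closed.

HB.instance Definition _ := GRing.Zmodule.on alg_quot.

Definition quot_class (a : A) : alg_quot := \pi_(Quotient.quot ideal_closed) a.
Definition quot_repr (q : alg_quot) : A :=
  repr (q : Quotient.quot ideal_closed).

Lemma quot_reprK q : quot_class (quot_repr q) = q.
Proof. exact: reprK. Qed.

Lemma quot_classP a b :
  quot_class a = quot_class b <-> two_sided_ideal (a - b).
Proof.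
split=> [/eqP|/ideal_predP]; rewrite /quot_class.
  by rewrite -Quotient.idealrBE => /ideal_predP.
by move=> ab; apply/eqP; rewrite -Quotient.idealrBE; exact: ab.
Qed.

Lemma quot_class_is_zmod_morphism : zmod_morphism quot_class.
Proof. by move=> a b; rewrite /quot_class !piE. Qed.

HB.instance Definition _ :=
  GRing.isZmodMorphism.Build A alg_quot quot_class quot_class_is_zmod_morphism.

Definition quot_one : alg_quot := quot_class 1.

Fact quot_key : unit. Proof. by []. Qed.

Definition quot_mul (q r : alg_quot) : alg_quot :=
  locked_with quot_key (quot_class (quot_repr q * quot_repr r)).
Definition quot_scale (k : F) (q : alg_quot) : alg_quot :=
  locked_with quot_key (quot_class (k *: quot_repr q)).

Lemma quot_mulE a b :
  quot_mul (quot_class a) (quot_class b) = quot_class (a * b).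
Proof.
rewrite /quot_mul locked_withE.
set a' := quot_repr (quot_class a); set b' := quot_repr (quot_class b).
have Ia : two_sided_ideal (a' - a) by apply/quot_classP; exact: quot_reprK.
have Ib : two_sided_ideal (b' - b) by apply/quot_classP; exact: quot_reprK.
apply/quot_classP.
have -> : a' * b' - a * b = (a' - a) * b' + a * (b' - b).
  by rewrite mulrBl mulrBr addrA subrK.
by apply: Ideal_add; [exact: Ideal_mulr | exact: Ideal_mull].
Qed.

Lemma quot_scaleE k a : quot_scale k (quot_class a) = quot_class (k *: a).
Proof.
rewrite /quot_scale locked_withE; apply/quot_classP.
rewrite -scalerBr -[_ - a]mul1r scalerAl.
by apply: Ideal_mull; apply/quot_classP; exact: quot_reprK.
Qed.

Lemma quot_mulA : associative quot_mul.
Proof.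
move=> x y z; rewrite -[x]quot_reprK -[y]quot_reprK -[z]quot_reprK.
by rewrite !quot_mulE mulrA.
Qed.

Lemma quot_mul1 : left_id quot_one quot_mul.
Proof. by move=> x; rewrite -[x]quot_reprK quot_mulE mul1r. Qed.

Lemma quot_mulr1 : right_id quot_one quot_mul.
Proof. by move=> x; rewrite -[x]quot_reprK quot_mulE mulr1. Qed.

Lemma quot_mulDl : left_distributive quot_mul +%R.
Proof.
move=> x y z; rewrite -[x]quot_reprK -[y]quot_reprK -[z]quot_reprK.
by rewrite -raddfD !quot_mulE -raddfD mulrDl.
Qed.

Lemma quot_mulDr : right_distributive quot_mul +%R.
Proof.
move=> x y z; rewrite -[x]quot_reprK -[y]quot_reprK -[z]quot_reprK.
by rewrite -raddfD !quot_mulE -raddfD mulrDr.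
Qed.

HB.instance Definition _ := GRing.Zmodule_isPzRing.Build alg_quot
  quot_mulA quot_mul1 quot_mulr1 quot_mulDl quot_mulDr.

Lemma quot_class_is_monoid_morphism : monoid_morphism quot_class.
Proof. by split=> // a b; rewrite -quot_mulE. Qed.

HB.instance Definition _ :=
  GRing.isMonoidMorphism.Build A alg_quot quot_class
    quot_class_is_monoid_morphism.

Lemma quot_scaleA a b v :
  quot_scale a (quot_scale b v) = quot_scale (a * b) v.
Proof. by rewrite -[v]quot_reprK !quot_scaleE scalerA. Qed.

Lemma quot_scale1 : left_id 1 quot_scale.
Proof. by move=> v; rewrite -[v]quot_reprK quot_scaleE scale1r. Qed.

Lemma quot_scaleDr : right_distributive quot_scale +%R.
Proof.
move=> k u v; rewrite -[u]quot_reprK -[v]quot_reprK.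
by rewrite -raddfD !quot_scaleE -raddfD scalerDr.
Qed.

Lemma quot_scaleDl v : {morph quot_scale^~ v : a b / a + b}.
Proof.
by move=> a b; rewrite -[v]quot_reprK !quot_scaleE -raddfD scalerDl.
Qed.

HB.instance Definition _ := GRing.Zmodule_isLmodule.Build F alg_quot
  quot_scaleA quot_scale1 quot_scaleDr quot_scaleDl.

Lemma quot_class_is_scalable : scalable quot_class.
Proof. by move=> k a; rewrite -quot_scaleE. Qed.

HB.instance Definition _ :=
  GRing.isScalable.Build F A alg_quot *:%R quot_class quot_class_is_scalable.

Lemma quot_scalerAl (k : F) (u v : alg_quot) : k *: (u * v) = (k *: u) * v.
Proof.
rewrite -[u]quot_reprK -[v]quot_reprK.
by rewrite -rmorphM -!linearZ -rmorphM scalerAl.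
Qed.

Lemma quot_scalerAr (k : F) (u v : alg_quot) : k *: (u * v) = u * (k *: v).
Proof.
rewrite -[u]quot_reprK -[v]quot_reprK.
by rewrite -rmorphM -!linearZ -rmorphM scalerAr.
Qed.

End PresentedAlgebra.

Section BannaiIto.
Variable F : fieldType.

Local Notation FA := (free_alg F 'I_3).

Definition free_X : FA := free_gen F (inord 0).
Definition free_Y : FA := free_gen F (inord 1).
Definition free_Z : FA := free_gen F (inord 2).

(* Centrality in BI of kappa, lambda and mu: commutators with every element,
   not only with the generators, are killed. *)
Inductive BI_rel : FA -> Prop :=
| BI_rel_kappa w : BI_rel (comm_br (bi_kappa free_X free_Y free_Z) w)
| BI_rel_lambda w : BI_rel (comm_br (bi_lambda free_X free_Y free_Z) w)
| BI_rel_mu w : BI_rel (comm_br (bi_mu free_X free_Y free_Z) w).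

Definition BI : Type := alg_quot BI_rel.

HB.instance Definition _ := GRing.PzRing.on BI.
HB.instance Definition _ := GRing.Lmodule.on BI.

(* Commutators have no constant term, so BI is not the zero ring. *)
Lemma BI_oner_neq0 : (1 : BI) != 0.
Proof.
pose aug : {rmorphism {malg F[{fmonom 'I_3}]} -> F} := mcoeff mone.
have aug_comm a b : aug (comm_br a b) = 0.
  by rewrite rmorph_comm_br /comm_br mulrC subrr.
apply/eqP => one0.
have {one0} : two_sided_ideal BI_rel (1 - 0).
  by apply/quot_classP; rewrite raddf0; exact: one0.
suff aug0 p : two_sided_ideal BI_rel p -> aug p = 0.
  by rewrite subr0 => /aug0/eqP; rewrite [aug _]rmorph1 oner_eq0.
elim=> {p} [p [] w||p q _ p0 _ q0|a p _ p0|a p _ p0].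
- exact: aug_comm.
- exact: aug_comm.
- exact: aug_comm.
- exact: (rmorph0 aug).
- by rewrite [LHS](rmorphD aug p q) p0 q0 addr0.
- by rewrite [LHS](rmorphM aug a p) p0 mulr0.
- by rewrite [LHS](rmorphM aug p a) p0 mul0r.
Qed.

HB.instance Definition _ := GRing.PzSemiRing_isNonZero.Build BI BI_oner_neq0.
HB.instance Definition _ :=
  GRing.LSemiModule_isLSemiAlgebra.Build F BI (@quot_scalerAl F FA BI_rel).
HB.instance Definition _ :=
  GRing.LSemiAlgebra_isSemiAlgebra.Build F BI (@quot_scalerAr F FA BI_rel).

Definition BI_X : BI := quot_class BI_rel free_X.
Definition BI_Y : BI := quot_class BI_rel free_Y.
Definition BI_Z : BI := quot_class BI_rel free_Z.

Definition BI_kappa : BI := bi_kappa BI_X BI_Y BI_Z.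
Definition BI_lambda : BI := bi_lambda BI_X BI_Y BI_Z.
Definition BI_mu : BI := bi_mu BI_X BI_Y BI_Z.

Lemma BI_central p : (forall w, BI_rel (comm_br p w)) ->
  central (quot_class BI_rel p : BI).
Proof.
move=> rel_p u; rewrite -[u]quot_reprK; set w := quot_repr u.
rewrite -!rmorphM.
by apply/quot_classP; exact: Ideal_gen (rel_p w).
Qed.

Lemma BI_kappa_central : central BI_kappa.
Proof.
have := BI_central BI_rel_kappa.
by rewrite rmorph_bi_kappa.
Qed.

Lemma BI_lambda_central : central BI_lambda.
Proof.
have := BI_central BI_rel_lambda.
by rewrite rmorph_bi_lambda.
Qed.

Lemma BI_mu_central : central BI_mu.
Proof.
have := BI_central BI_rel_mu.
by rewrite rmorph_bi_mu.
Qed.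

(* Existence half of the universal property; uniqueness holds because BI is
   generated by BI_X, BI_Y and BI_Z. *)
Lemma BI_universal (A : algType F) (x y z : A) :
  central (bi_kappa x y z) -> central (bi_lambda x y z) ->
  central (bi_mu x y z) ->
  exists f : BI -> A,
    [/\ linear f, monoid_morphism f, f BI_X = x, f BI_Y = y & f BI_Z = z].
Proof.
move=> hk hl hm.
pose g (i : 'I_3) := nth 0 [:: x; y; z] i.
pose h (m : {fmonom 'I_3}) : A := \prod_(i <- m) g i.
pose f0 (p : FA) : A := \sum_(k <- msupp p) p@_k *: h k.
have f0w p (d : {fset {fmonom 'I_3}}) :
  (msupp p `<=` d)%fset -> f0 p = \sum_(k <- d) p@_k *: h k.
  move=> le; apply: big_fset_incl => // k _ /mcoeff_outdom ->.
  exact: scale0r.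
have f0D p q : f0 (p + q) = f0 p + f0 q.
  rewrite (f0w _ _ (msuppD_le p q)).
  rewrite (f0w p _ (fsubsetUl _ (msupp q))).
  rewrite (f0w q _ (fsubsetUr (msupp p) _)).
  rewrite -big_split /=.
  by apply: eq_bigr => i _; rewrite mcoeffD scalerDl.
have f0U c m : f0 << c *g m >> = c *: h m.
  by rewrite (f0w _ _ (msuppU_le)) big_seq_fset1 mcoeffUU.
have f00 : f0 0 = 0 by rewrite /f0 msupp0 big_seq_fset0.
have f0S T (s : seq T) (E : T -> FA) :
  f0 (\sum_(i <- s) E i) = \sum_(i <- s) f0 (E i).
  by apply: (big_morph f0 f0D f00).
have hM m n : h (mmul m n) = h m * h n by rewrite /h fmM big_cat.
have f0M p q : f0 (p * q) = f0 p * f0 q.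
  rewrite malgME f0S /f0 mulr_suml; apply: eq_bigr => i _.
  rewrite [LHS]f0S mulr_sumr; apply: eq_bigr => j _.
  by rewrite f0U hM -scalerAl -scalerAr scalerA.
have f0Z c p : f0 (c *: p) = c *: f0 p.
  have -> : c *: p = << c *g mone >> * p by exact/esym/mul_malgC.
  by rewrite f0M f0U /h fm1 big_nil -scalerAl mul1r.
have f01 : f0 1 = 1 by rewrite [f0 1]f0U /h fm1 big_nil scale1r.
have f0N p : f0 (- p) = - f0 p by rewrite -scaleN1r f0Z scaleN1r.
have f0B p q : f0 (p - q) = f0 p - f0 q by rewrite (f0D p) (f0N q).
have f0g i : f0 (free_gen F i) = g i.
  by rewrite free_genE f0U scale1r /h fmU big_seq1.
have gX : f0 free_X = x by rewrite f0g /g inordK.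
have gY : f0 free_Y = y by rewrite f0g /g inordK.
have gZ : f0 free_Z = z by rewrite f0g /g inordK.
pose f0zmod := GRing.isZmodMorphism.Build FA A f0 f0B.
pose f0mon := GRing.isMonoidMorphism.Build FA A f0 (conj f01 f0M).
pose f1 : {rmorphism FA -> A} := HB.pack f0 f0zmod f0mon.
have f1C p w : central (f1 p) -> f1 (comm_br p w) = 0.
  by move=> cp; rewrite rmorph_comm_br /comm_br cp subrr.
have f0I p : two_sided_ideal BI_rel p -> f0 p = 0.
  elim=> {p} [p [] w||p q _ p0 _ q0|a p _ p0|a p _ p0]; last 4 first.
  - exact: f00.
  - by rewrite f0D p0 q0 addr0.
  - by rewrite f0M p0 mulr0.
  - by rewrite f0M p0 mul0r.
  - by apply: f1C; rewrite rmorph_bi_kappa /= gX gY gZ.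
  - by apply: f1C; rewrite rmorph_bi_lambda /= gX gY gZ.
  - by apply: f1C; rewrite rmorph_bi_mu /= gX gY gZ.
pose f (u : BI) : A := f0 (quot_repr u).
have fc p : f (quot_class _ p) = f0 p.
  apply/eqP; rewrite -subr_eq0 -f0N -f0D; apply/eqP/f0I/quot_classP.
  exact: quot_reprK.
exists f; split.
- move=> k a b; rewrite -[a]quot_reprK -[b]quot_reprK -linearP !fc.
  by rewrite f0D f0Z.
- split; first exact: (etrans (fc 1)).
  by move=> a b; rewrite -[a]quot_reprK -[b]quot_reprK -rmorphM !fc f0M.
- by rewrite fc.
- by rewrite fc.
- by rewrite fc.
Qed.

End BannaiIto.

(* Main.v *)
Require Import Defs.
From HB Require Import structures.
From mathcomp Require Import all_boot all_algebra.
From mathcomp Require Import ring zify boolp monalg.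

Set Implicit Arguments.
Unset Strict Implicit.
Unset Printing Implicit Defensive.

Import GRing.Theory.
Local Open Scope ring_scope.

(* Spanning: modulo the relations, moving Y or Z past X, and Z past Y, only
   creates monomials of smaller degree in X, Y, Z, so an induction on this
   degree shows that left multiplication by a generator preserves the span.

   Independence: put U = Y + Z and W = Y - Z. The relations become
     U X = (1 - X) U + kappa + mu,   W X = (- 1 - X) W + kappa - mu,
     U^2 - W^2 = 2 X + 2 lambda,
   so U and W act on polynomials in X as reflections plus multiples of divided
   differences. Adjoining C (the Casimir element X^2 + Y^2 + Z^2), with
   U^2 = C - X^2 + X + lambda and W^2 = C - X^2 - X - lambda, gives a model on
   pairs of polynomials in X and C in which U and W exchange the two
   components. Give C weight 2 and the second component weight 1. If U and W
   send (1, 0) to (0, h + 1) and (0, h - 1) for a transcendental h, then the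
   part of weight j + k of Y^j Z^k (1, 0) is h^j times a factor which depends,
   up to sign, only on j + k. *)

Local Notation index := (nat * nat * nat * nat * nat * nat)%type.

Definition bi_monomial (A : pzRingType) (x y z : A) (n : index) : A :=
  let: (i, j, k, r, s, t) := n in
  x ^+ i * y ^+ j * z ^+ k
    * bi_kappa x y z ^+ r * bi_lambda x y z ^+ s * bi_mu x y z ^+ t.

(** * Spanning *)

Definition xyz_degree (n : index) : nat :=
  let: (i, j, k, r, s, t) := n in (i + j + k)%N.

Section OrderedMonomials.
Variables (F : fieldType) (B : algType F) (x y z : B).
Local Notation kap := (bi_kappa x y z).
Local Notation lam := (bi_lambda x y z).
Local Notation mu := (bi_mu x y z).
Hypotheses (kapC : central kap) (lamC : central lam) (muC : central mu).

Local Notation mono := (bi_monomial x y z).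

(** The bound [n] makes this a filtration: the correction terms of the commutation rules fall into
    smaller steps of it, which drives the induction in [mono_span_yz]. *)
Inductive mono_span n : B -> Prop :=
| mono_span0 : mono_span n 0
| mono_spanD u v : mono_span n u -> mono_span n v -> mono_span n (u + v)
| mono_spanM c m : (xyz_degree m <= n)%N -> mono_span n (c *: mono m).

Lemma mono_span_le n n' v : (n <= n')%N -> mono_span n v -> mono_span n' v.
Proof.
move=> nn'; elim=> [|u w _ + _|c m mn]; [exact: mono_span0|exact: mono_spanD|].
by apply: mono_spanM; exact: leq_trans nn'.
Qed.

Lemma mono_spanZ n c v : mono_span n v -> mono_span n (c *: v).
Proof.
elim=> [|u w _ su _ sw|d m mn]; first by rewrite scaler0; exact: mono_span0.
  by rewrite scalerDr; exact: mono_spanD.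
by rewrite scalerA; exact: mono_spanM.
Qed.

Lemma mono_spanN n v : mono_span n v -> mono_span n (- v).
Proof. by rewrite -scaleN1r; exact: mono_spanZ. Qed.

Lemma mono_span_mull n n' (a : B) :
  (forall m, (xyz_degree m <= n)%N -> mono_span n' (a * mono m)) ->
  forall v, mono_span n v -> mono_span n' (a * v).
Proof.
move=> am v; elim=> [|u w _ su _ sw|d m mn].
- by rewrite mulr0; exact: mono_span0.
- by rewrite mulrDr; exact: mono_spanD.
- by rewrite -scalerAr; exact: mono_spanZ (am _ mn).
Qed.

Lemma mono_span1 n m : (xyz_degree m <= n)%N -> mono_span n (mono m).
Proof. by move=> mn; rewrite -[mono m]scale1r; exact: mono_spanM. Qed.

Lemma mono_span_kappa n v : mono_span n v -> mono_span n (kap * v).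
Proof.
apply: mono_span_mull => [[[[[[i j] k] r] s] t]] mn.
have -> : kap * mono (i, j, k, r, s, t) = mono (i, j, k, r.+1, s, t).
  rewrite /bi_monomial exprS !mulrA.
  by rewrite -(kapC (x ^+ i * y ^+ j * z ^+ k)) !mulrA.
exact: mono_span1.
Qed.

Lemma mono_span_lambda n v : mono_span n v -> mono_span n (lam * v).
Proof.
apply: mono_span_mull => [[[[[[i j] k] r] s] t]] mn.
have -> : lam * mono (i, j, k, r, s, t) = mono (i, j, k, r, s.+1, t).
  rewrite /bi_monomial exprS !mulrA.
  by rewrite -(lamC (x ^+ i * y ^+ j * z ^+ k * kap ^+ r)) !mulrA.
exact: mono_span1.
Qed.

Lemma mono_span_mu n v : mono_span n v -> mono_span n (mu * v).
Proof.
apply: mono_span_mull => [[[[[[i j] k] r] s] t]] mn.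
have -> : mu * mono (i, j, k, r, s, t) = mono (i, j, k, r, s, t.+1).
  rewrite /bi_monomial exprS !mulrA.
  by rewrite -(muC (x ^+ i * y ^+ j * z ^+ k * kap ^+ r * lam ^+ s)) !mulrA.
exact: mono_span1.
Qed.

Lemma mono_xS i j k r s t :
  mono (i.+1, j, k, r, s, t) = x * mono (i, j, k, r, s, t).
Proof. by rewrite /bi_monomial exprS !mulrA. Qed.

Lemma mono_yS j k r s t :
  mono (0, j.+1, k, r, s, t)%N = y * mono (0, j, k, r, s, t)%N.
Proof. by rewrite /bi_monomial !mul1r exprS !mulrA. Qed.

Lemma mono_zS k r s t :
  mono (0, 0, k.+1, r, s, t)%N = z * mono (0, 0, k, r, s, t)%N.
Proof. by rewrite /bi_monomial !mul1r exprS !mulrA. Qed.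

Lemma mono_span_x n v : mono_span n v -> mono_span n.+1 (x * v).
Proof.
apply: mono_span_mull => [[[[[[i j] k] r] s] t]] mn.
by rewrite -mono_xS; exact: mono_span1.
Qed.

(** When [c] is the third generator, the last coefficient is one of the central elements [kap],
    [lam], [mu]. *)
Let swap (a b c v : B) :
  b * (a * v) = - (a * (b * v)) + c * v + (anticomm a b - c) * v.
Proof.
by rewrite -[RHS]addrA -mulrDl subrKC /anticomm mulrDl !mulrA addKr.
Qed.

Let yx v : y * (x * v) = - (x * (y * v)) + z * v + kap * v.
Proof. exact: swap. Qed.
Let zx v : z * (x * v) = - (x * (z * v)) + y * v + mu * v.
Proof. by rewrite /bi_mu [anticomm z x]addrC; exact: swap. Qed.
Let zy v : z * (y * v) = - (y * (z * v)) + x * v + lam * v.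
Proof. exact: swap. Qed.

(** The two claims need a joint induction: moving [y] past [x] produces [z] and moving [z] past [x]
    produces [y], each applied to a monomial of smaller degree. *)
Lemma mono_span_yz n : (forall v, mono_span n v -> mono_span n.+1 (y * v)) /\
  (forall v, mono_span n v -> mono_span n.+1 (z * v)).
Proof.
elim: n => [|n [IHy IHz]].
  split; apply: mono_span_mull => [[[[[[[|i] [|j]] [|k]] r] s] t]] // mn.
    by rewrite -mono_yS; exact: mono_span1.
  by rewrite -mono_zS; exact: mono_span1.
have le := @mono_span_le n n.+2 _ (leqW (leqnSn n)).
have le1 := @mono_span_le n.+1 n.+2 _ (leqnSn _).
(* The claim for [y] comes first, because moving [z] past [y] applies [y] to an element of degree up
   to [n.+1]. *)
have IHy' : forall v, mono_span n.+1 v -> mono_span n.+2 (y * v).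
  apply: mono_span_mull => [[[[[[[|i] j] k] r] s] t]] mn.
    by rewrite -mono_yS; exact: mono_span1.
  have sm : mono_span n (mono (i, j, k, r, s, t)) by exact: mono_span1.
  rewrite mono_xS yx; apply: mono_spanD; first apply: mono_spanD.
  - by apply/mono_spanN/mono_span_x/IHy.
  - exact/le1/IHz.
  - exact/le/mono_span_kappa.
split=> //; apply: mono_span_mull => [[[[[[[|i] j] k] r] s] t]] mn.
  case: j mn => [|j] mn; first by rewrite -mono_zS; exact: mono_span1.
  have sm : mono_span n (mono (0, j, k, r, s, t)%N) by exact: mono_span1.
  rewrite mono_yS zy; apply: mono_spanD; first apply: mono_spanD.
  - exact/mono_spanN/IHy'/IHz.
  - exact/le1/mono_span_x.
  - exact/le/mono_span_lambda.
have sm : mono_span n (mono (i, j, k, r, s, t)) by exact: mono_span1.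
rewrite mono_xS zx; apply: mono_spanD; first apply: mono_spanD.
- by apply/mono_spanN/mono_span_x/IHz.
- exact/le1/IHy.
- exact/le/mono_span_mu.
Qed.

Definition in_mono_span v := exists n, mono_span n v.

Lemma in_mono_spanP v : in_mono_span v ->
  exists (s : seq index) (c : index -> F), v = \sum_(m <- s) c m *: mono m.
Proof.
move=> [n]; suff vl : mono_span n v ->
    exists l : seq (F * index), v = \sum_(p <- l) p.1 *: mono p.2.
  (* An index may occur in several terms of [l]; it is listed once and its coefficients are added
     up. *)
  case/vl => l ->; exists (undup [seq p.2 | p <- l]).
  exists (fun m => \sum_(p <- l | p.2 == m) p.1).
  under [RHS]eq_bigr => m _ do rewrite scaler_suml big_mkcond.
  rewrite exchange_big; apply: eq_big_seq => p pl; rewrite -big_mkcond /=.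
  under eq_bigl => m do rewrite eq_sym.
  rewrite -big_filter filter_pred1_uniq ?undup_uniq ?big_seq1 //.
  by rewrite mem_undup; exact: map_f.
elim=> [|u w _ [l1 ->] _ [l2 ->]|c m _]; first by exists [::]; rewrite big_nil.
  by exists (l1 ++ l2); rewrite big_cat.
by exists [:: (c, m)]; rewrite big_seq1.
Qed.

End OrderedMonomials.

(** * Spanning in the Bannai-Ito algebra itself *)

Section Spanning.
Variable F : fieldType.
Local Notation X := (BI_X F).
Local Notation Y := (BI_Y F).
Local Notation Z := (BI_Z F).
Local Notation FA := (free_alg F 'I_3).

Let kapC := @BI_kappa_central F.
Let lamC := @BI_lambda_central F.
Let muC := @BI_mu_central F.

(** Every class comes from a combination of words in the free algebra; a word is built from the
    empty one by adding letters on the left, and each letter preserves the span. *)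
Lemma BI_monomials_span (v : BI F) : in_mono_span X Y Z v.
Proof.
have [p ->] : exists p : FA, v = quot_class _ p.
  by exists (quot_repr v); rewrite quot_reprK.
have spanD (u w : BI F) : in_mono_span X Y Z u -> in_mono_span X Y Z w ->
    in_mono_span X Y Z (u + w).
  move=> [n un] [m wm]; exists (maxn n m); apply: mono_spanD.
    exact: mono_span_le (leq_maxl _ _) un.
  exact: mono_span_le (leq_maxr _ _) wm.
have spanM (i : 'I_3) (w : BI F) : in_mono_span X Y Z w ->
    in_mono_span X Y Z (quot_class _ (free_gen F i) * w).
  move=> [n wn]; exists n.+1.
  have [spanY spanZ] := mono_span_yz kapC lamC muC n.
  rewrite -(inord_val i); case: i => [[|[|[|]]] //= _].
  - exact: mono_span_x.
  - exact: spanY.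
  - exact: spanZ.
rewrite (monalgE p) raddf_sum; elim/big_ind: _ => [|u w|[l] _].
- by exists 0; exact: mono_span0.
- exact: spanD.
move: (p@_ _) => c; elim: l => [|i l IHl].
  exists 0; have -> : << c *g FMonom [::] >> = c *: (1 : FA).
    have -> : FMonom [::] = mone :> {fmonom 'I_3}.
      by apply: val_inj; rewrite /= fm1.
    by rewrite -[RHS]mul_malgC [RHS]mulr1.
  rewrite [u in mono_span _ _ _ _ u](_ :
      _ = c *: bi_monomial X Y Z (0, 0, 0, 0, 0, 0)%N); first exact: mono_spanM.
  by rewrite /= !mulr1; exact/esym/quot_scaleE.
have -> : << c *g FMonom (i :: l) >> = free_gen F i * << c *g FMonom l >>.
  rewrite free_genE; symmetry; apply: etrans (fgmulUU _ _ _ _) _.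
  by rewrite mul1r; congr << _ *g _ >>; apply: val_inj; rewrite /= fmM fmU.
rewrite [u in in_mono_span _ _ _ u](_ :
    _ = quot_class (@BI_rel F) (free_gen F i)
      * quot_class (@BI_rel F) << c *g FMonom l >>); first exact: spanM.
exact/esym/quot_mulE.
Qed.
End Spanning.

(** * Endomorphism algebras *)

Section Endomorphisms.
Variables (K L : comNzRingType) (iota : {rmorphism K -> L}).
Variable V : lalgType L.

(** Multiplication by [X] must be an operator that fails to commute with the others, so [V] is a
    module over [L] while linearity is asked only over [K], mapped to [L] by [iota]. *)
Record endo := Endo {
  endo_fun :> V -> V;
  endo_additive : zmod_morphism endo_fun;
  endo_scale : forall k v, endo_fun (iota k *: v) = iota k *: endo_fun v }.

Lemma endoP (f g : endo) : f =1 g -> f = g.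
Proof.
case: f g => [f fB fZ] [g gB gZ] /= /funext fg; case: _ / fg gB gZ => gB gZ.
by congr Endo; exact: Prop_irrelevance.
Qed.

HB.instance Definition _ := gen_eqMixin endo.
HB.instance Definition _ := gen_choiceMixin endo.

HB.instance Definition _ (f : endo) :=
  GRing.isZmodMorphism.Build V V (endo_fun f) (endo_additive f).

Program Definition endo_zero := @Endo (fun=> 0) _ _.
Next Obligation. by move=> u v; rewrite subr0. Qed.
Next Obligation. by rewrite scaler0. Qed.

Program Definition endo_opp (f : endo) := @Endo (fun v => - f v) _ _.
Next Obligation. by move=> u v; rewrite raddfB opprD. Qed.
Next Obligation. by rewrite endo_scale scalerN. Qed.

Program Definition endo_add (f g : endo) := @Endo (fun v => f v + g v) _ _.
Next Obligation. by move=> u v; rewrite !raddfB opprD addrACA. Qed.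
Next Obligation. by rewrite !endo_scale scalerDr. Qed.

Definition endo_one := @Endo id (fun _ _ => erefl) (fun _ _ => erefl).

Program Definition endo_comp (f g : endo) := @Endo (fun v => f (g v)) _ _.
Next Obligation. by move=> u v; rewrite !raddfB. Qed.
Next Obligation. by rewrite !endo_scale. Qed.

Program Definition endo_const (k : K) := @Endo (fun v => iota k *: v) _ _.
Next Obligation. by move=> u v; rewrite scalerBr. Qed.
Next Obligation. by rewrite !scalerA mulrC. Qed.

Fact endo_addA : associative endo_add.
Proof. by move=> f g h; apply: endoP => v /=; rewrite addrA. Qed.
Fact endo_addC : commutative endo_add.
Proof. by move=> f g; apply: endoP => v /=; rewrite addrC. Qed.
Fact endo_add0 : left_id endo_zero endo_add.
Proof. by move=> f; apply: endoP => v /=; rewrite add0r. Qed.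
Fact endo_addN : left_inverse endo_zero endo_opp endo_add.
Proof. by move=> f; apply: endoP => v /=; rewrite addNr. Qed.

HB.instance Definition _ :=
  GRing.isZmodule.Build endo endo_addA endo_addC endo_add0 endo_addN.

Fact endo_compA : associative endo_comp.
Proof. by move=> f g h; apply: endoP. Qed.
Fact endo_comp1 : left_id endo_one endo_comp.
Proof. by move=> f; apply: endoP. Qed.
Fact endo_compr1 : right_id endo_one endo_comp.
Proof. by move=> f; apply: endoP. Qed.
Fact endo_compDl : left_distributive endo_comp +%R.
Proof. by move=> f g h; apply: endoP. Qed.
Fact endo_compDr : right_distributive endo_comp +%R.
Proof. by move=> f g h; apply: endoP => v /=; rewrite raddfD. Qed.
Fact endo_one_neq0 : endo_one != 0.
Proof.
apply/eqP => /(congr1 (fun f : endo => f 1)) /= /eqP.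
by rewrite oner_eq0.
Qed.

HB.instance Definition _ := GRing.Zmodule_isNzRing.Build endo
  endo_compA endo_comp1 endo_compr1 endo_compDl endo_compDr endo_one_neq0.

Lemma endoDE (f g : endo) v : (f + g) v = f v + g v. Proof. by []. Qed.
Lemma endoNE (f : endo) v : (- f) v = - f v. Proof. by []. Qed.
Lemma endoME (f g : endo) v : (f * g) v = f (g v). Proof. by []. Qed.

Lemma endo_constX k n v : (endo_const k ^+ n) v = iota (k ^+ n) *: v.
Proof.
elim: n => [|n IHn]; first by rewrite rmorph1 scale1r.
by rewrite exprS endoME IHn /= scalerA -rmorphM -exprS.
Qed.

Lemma endo_const_central k : central (endo_const k).
Proof. by move=> f; apply: endoP => v /=; rewrite endo_scale. Qed.

(* Carries j so that the F-algebra structure below can be inferred. *)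
Definition endo_restr (F : fieldType) (j : {rmorphism F -> K}) : Type := endo.

HB.instance Definition _ (F : fieldType) (j : {rmorphism F -> K}) :=
  GRing.NzRing.on (endo_restr j).

Section RestrictedScalars.
Variables (F : fieldType) (j : {rmorphism F -> K}).

Definition endo_fscale (c : F) (f : endo_restr j) : endo_restr j :=
  endo_comp (endo_const (j c)) f.

Fact endo_fscaleA a b f :
  endo_fscale a (endo_fscale b f) = endo_fscale (a * b) f.
Proof. by apply: endoP => v /=; rewrite scalerA !rmorphM. Qed.
Fact endo_fscale1 : left_id 1 endo_fscale.
Proof. by move=> f; apply: endoP => v /=; rewrite !rmorph1 scale1r. Qed.
Fact endo_fscaleDr : right_distributive endo_fscale +%R.
Proof. by move=> c f g; apply: endoP => v /=; rewrite scalerDr. Qed.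
Fact endo_fscaleDl f : {morph endo_fscale^~ f : a b / a + b}.
Proof. by move=> a b; apply: endoP => v /=; rewrite !rmorphD scalerDl. Qed.

HB.instance Definition _ := GRing.Zmodule_isLmodule.Build F (endo_restr j)
  endo_fscaleA endo_fscale1 endo_fscaleDr endo_fscaleDl.

Fact endo_fscaleAl (c : F) (f g : endo_restr j) : c *: (f * g) = (c *: f) * g.
Proof. by apply: endoP. Qed.
HB.instance Definition _ :=
  GRing.Lmodule_isLalgebra.Build F (endo_restr j) endo_fscaleAl.

Fact endo_fscaleAr (c : F) (f g : endo_restr j) : c *: (f * g) = f * (c *: g).
Proof. by apply: endoP => v /=; rewrite endo_scale. Qed.
HB.instance Definition _ :=
  GRing.Lalgebra_isAlgebra.Build F (endo_restr j) endo_fscaleAr.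

End RestrictedScalars.
End Endomorphisms.

(** * The model *)

Section TwistedDerivation.
Variables (Q : idomainType) (s : {rmorphism Q -> Q}) (D : Q -> Q) (d : Q).
Hypotheses (sK : involutive s) (d0 : d != 0) (sd : s d = - d).
Hypothesis Dd : forall q, D q * d = q - s q.

(** All that is known of [D] is [Dd], so identities are checked after multiplication by [d], which
    is then cancelled in the domain. *)
Lemma twisted_Leibniz a b : D (a * b) = D a * b + s a * D b.
Proof.
apply: (mulIf d0); rewrite mulrDl Dd mulrAC Dd -mulrA Dd rmorphM.
ring.
Qed.

Lemma twisted_zmod_morphism : zmod_morphism D.
Proof. by move=> a b; apply: (mulIf d0); rewrite mulrBl !Dd rmorphB; ring. Qed.

Lemma twisted_fix a b : s a = a -> D (a * b) = a * D b.
Proof.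
move=> sa; rewrite twisted_Leibniz sa.
suff -> : D a = 0 by rewrite mul0r add0r.
by apply: (mulIf d0); rewrite Dd sa subrr mul0r.
Qed.

(** Both [q - s q] and [d] change sign under [s], so their quotient is invariant. *)
Lemma twisted_sD q : s (D q) = D q.
Proof.
apply: (mulIf d0); rewrite Dd; have := congr1 s (Dd q).
rewrite rmorphM rmorphB sK sd => /(congr1 -%R).
by rewrite mulrN opprK opprB.
Qed.

Lemma twisted_Ds q : D (s q) = - D q.
Proof. by apply: (mulIf d0); rewrite mulNr !Dd sK opprB. Qed.

Lemma twisted_DD q : D (D q) = 0.
Proof. by apply: (mulIf d0); rewrite Dd twisted_sD subrr mul0r. Qed.

Variables (P p p' al : Q).
Hypotheses (sP : s P = P) (sp : s p = p) (sp' : s p' = p') (sal : s al = al).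
Hypothesis pp' : p' * p = 1.

(** A reflection that exchanges the components, plus [al] times the divided difference. The factor
    [P] enters only on the way back to the first component, and [p], [p'] are inverse to each other,
    so they cancel in the square. *)
Definition bi_half (f : Q * Q) : Q * Q :=
  (p' * (P * s f.2) + al * D f.1, p * s f.1 + al * D f.2).

Lemma bi_half_zmod_morphism : zmod_morphism bi_half.
Proof.
move=> [f g] [f' g']; rewrite /bi_half; congr pair => /=;
rewrite !rmorphB twisted_zmod_morphism; ring.
Qed.

Lemma bi_half_fix a f : s a = a ->
  bi_half (a * f.1, a * f.2) = (a * (bi_half f).1, a * (bi_half f).2).
Proof.
by move=> sa; rewrite /bi_half /= !rmorphM sa !twisted_fix //; congr pair; ring.
Qed.

(** The cross terms cancel since [s (D q) = D q] while [D (s q) = - D q]; the term in [al] squared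
    vanishes since [D (D q) = 0]. *)
Lemma bi_half_sqr f : bi_half (bi_half f) = (P * f.1, P * f.2).
Proof.
have DB a b : D (a + b) = D a + D b.
  by apply: (mulIf d0); rewrite mulrDl !Dd rmorphD; ring.
rewrite /bi_half /= !DB !rmorphD !rmorphM !sK sP sp sp' sal.
rewrite !twisted_fix // !twisted_DD !twisted_sD !twisted_Ds.
congr pair.
- transitivity (p' * p * (P * f.1)); first ring.
  by rewrite pp' mul1r.
- transitivity (p' * p * (P * f.2)); first ring.
  by rewrite pp' mul1r.
Qed.

(** With [d + c] equal to [X] this is the relation between [U] or [W] and [X]: [s] sends [d + c] to
    [c - d], and [D (d + c)] is 2. *)
Lemma bi_half_mul c f : s c = c ->
  bi_half ((d + c) * f.1, (d + c) * f.2) =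
  ((c - d) * (bi_half f).1 + 2 * al * f.1,
   (c - d) * (bi_half f).2 + 2 * al * f.2).
Proof.
move=> sc; rewrite /bi_half /= !rmorphM rmorphD sd sc.
have D2 q : D ((d + c) * q) = (c - d) * D q + 2 * q.
  apply: (mulIf d0).
  by rewrite [RHS]mulrDl -mulrA !Dd rmorphM rmorphD sd sc; ring.
by rewrite !D2; congr pair; ring.
Qed.

End TwistedDerivation.

(** * Affine reflections and divided differences of polynomials *)

Section Reflection.
Variables (K : fieldType) (c : K).
Local Notation Q := {poly {poly K}}.

Definition refl : {poly K} -> {poly K} := comp_poly ((2 * c)%:P - 'X).
HB.instance Definition _ := GRing.RMorphism.on refl.

Lemma reflK : involutive refl.
Proof.
move=> p; rewrite /refl -comp_polyA rmorphB /= comp_polyC comp_polyX.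
by rewrite subKr comp_polyXr.
Qed.

Lemma reflC a : refl a%:P = a%:P.
Proof. exact: comp_polyC. Qed.

Lemma reflX : refl 'X = (2 * c)%:P - 'X.
Proof. exact: comp_polyX. Qed.

Definition divdiff (p : {poly K}) : {poly K} := (p - refl p) %/ ('X - c%:P).

(** The reflection fixes the point [c], so [p - refl p] vanishes there and the division is exact. *)
Lemma divdiffE p : divdiff p * ('X - c%:P) = p - refl p.
Proof.
apply: divpK; rewrite dvdp_XsubCl /root hornerD hornerN horner_comp !hornerE.
by rewrite mulr_natl mulr2n addrK subrr.
Qed.

Definition reflQ : Q -> Q := map_poly refl.
HB.instance Definition _ := GRing.RMorphism.on reflQ.
Definition divdiffQ : Q -> Q := map_poly divdiff.
(** This serves as the element [d] of the twisted derivation; it is constant in the outer variable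
    C. *)
Definition center : Q := ('X - c%:P)%:P.

Lemma coef_reflQ q i : (reflQ q)`_i = refl q`_i.
Proof. exact: coef_map. Qed.

Lemma coef_divdiffQ q i : (divdiffQ q)`_i = divdiff q`_i.
Proof. by apply: coef_map_id0; rewrite /divdiff rmorph0 subr0 div0p. Qed.

Lemma reflQC a : reflQ a%:P = (refl a)%:P.
Proof. exact: map_polyC. Qed.

Lemma reflQK : involutive reflQ.
Proof. by move=> q; apply/polyP => i; rewrite !coef_reflQ reflK. Qed.

Lemma center_neq0 : center != 0.
Proof. by rewrite polyC_eq0 polyXsubC_eq0. Qed.

Lemma refl_center : reflQ center = - center.
Proof.
rewrite reflQC rmorphB /= reflX reflC /center -[RHS]polyCN; congr polyC.
by rewrite polyCM; ring.
Qed.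

Lemma divdiffQE q : divdiffQ q * center = q - reflQ q.
Proof.
apply/polyP=> i; rewrite coefMC coefB coef_reflQ coef_divdiffQ.
exact: divdiffE.
Qed.

Lemma size_reflQ q : (size (reflQ q) <= size q)%N.
Proof. exact: size_poly. Qed.

Lemma size_divdiffQ q : (size (divdiffQ q) <= size q)%N.
Proof. exact: size_poly. Qed.

End Reflection.

(** * Weights and leading symbols *)

Section Weight.
Variable K : fieldType.
Local Notation Q := {poly {poly K}}.

(* The outer polynomial variable is C, the inner one X; C^l has weight 2 l in the
   first component and 2 l + 1 in the second. *)
Definition weight_le N (v : Q * Q) :=
  (size v.1 <= N./2.+1)%N /\ (size v.2 <= uphalf N)%N.

(** Each weight belongs to exactly one power of C in one component: even weights to the first, odd
    weights to the second. *)
Definition symbol N (v : Q * Q) : {poly K} :=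
  if odd N then v.2`_N./2 else v.1`_N./2.

Lemma symbol_gt N M v : weight_le N v -> (N < M)%N -> symbol M v = 0.
Proof.
move=> [h1 h2] NM; rewrite /symbol; case: ifPn => oM; apply: nth_default.
  by apply: leq_trans h2 _; lia.
by apply: leq_trans h1 _; lia.
Qed.

Lemma symbol_zmod_morphism N : zmod_morphism (symbol N).
Proof. by move=> u v; rewrite /symbol; case: ifP => _; rewrite coefB. Qed.
HB.instance Definition _ N :=
  GRing.isZmodMorphism.Build (Q * Q)%type {poly K} (symbol N)
    (symbol_zmod_morphism N).

Lemma symbolZ N a v : symbol N (a *: v) = a * symbol N v.
Proof. by rewrite /symbol; case: ifP => _; rewrite coefZ. Qed.

Lemma weight_leD N u v : weight_le N u -> weight_le N v -> weight_le N (u + v).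
Proof.
move=> [u1 u2] [v1 v2]; split; apply: leq_trans (size_polyD _ _) _;
  by rewrite geq_max; apply/andP.
Qed.

Lemma weight_leZ N a v : weight_le N v -> weight_le N (a *: v).
Proof.
by move=> [v1 v2]; split; apply: leq_trans (size_scale_leq _ _) _.
Qed.

(** The parameter [k] cancels in the square but survives in the symbols, where it will separate [Y]
    from [Z]. *)
Definition half_op (c : K) (P0 : {poly K}) (k al : K) : Q * Q -> Q * Q :=
  bi_half (Q := Q) (reflQ c) (divdiffQ c) ('X + P0%:P : Q)
    (k%:P%:P : Q) (k^-1%:P%:P : Q) (al%:P%:P : Q).

(** The divided difference and [P0] do not raise the degree in C, so weight [N.+1] is reached only
    by the reflection part: with factor [k] from the first component, and with C and [k^-1] from the
    second. *)
Lemma half_op_weight c P0 k al N v : weight_le N v ->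
  weight_le N.+1 (half_op c P0 k al v) /\
  symbol N.+1 (half_op c P0 k al v) =
    (if odd N then k^-1 else k)%:P * refl c (symbol N v).
Proof.
move=> [h1 h2].
have sP : (size ('X + P0%:P : Q)%R <= 2)%N.
  rewrite (leq_trans (size_polyD _ _)) // geq_max size_polyX.
  by rewrite (leq_trans (size_polyC_leq1 _)).
split.
  split; rewrite /half_op /bi_half /=; apply: leq_trans (size_polyD _ _) _;
    rewrite geq_max; apply/andP; split.
  - rewrite mul_polyC; apply: leq_trans (size_scale_leq _ _) _.
    apply: leq_trans (size_polyMleq _ _) _.
    have := leq_trans (size_reflQ c v.2) h2.
    move: (size _) sP (size _) => a ha b hb.
    by rewrite uphalfE in hb *; lia.
  - rewrite mul_polyC; apply: leq_trans (size_scale_leq _ _) _.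
    by apply: leq_trans (leq_trans (size_divdiffQ c v.1) h1) _; lia.
  - rewrite mul_polyC; apply: leq_trans (size_scale_leq _ _) _.
    by apply: leq_trans (leq_trans (size_reflQ c v.1) h1) _; lia.
  - rewrite mul_polyC; apply: leq_trans (size_scale_leq _ _) _.
    by apply: leq_trans (leq_trans (size_divdiffQ c v.2) h2) _; lia.
rewrite /symbol /half_op /bi_half /=; case: (boolP (odd N)) => oN /=.
  rewrite coefD !coefCM mulrDl coefD coefXM coefCM !coef_reflQ.
  (* For odd [N] the target is the first component, and the outer ['X] raises the exponent by one;
     the other coefficients lie beyond the size bounds. *)
  have -> : uphalf N = N./2.+1 by lia.
  rewrite /= coef_divdiffQ.
  rewrite [v.1`__]nth_default; last by apply: leq_trans h1 _; lia.
  rewrite [v.2`_N./2.+1]nth_default; last by apply: leq_trans h2 _; lia.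
  by rewrite /divdiff !rmorph0 subr0 div0p !mulr0 !addr0.
rewrite coefD !coefCM.
have -> : uphalf N = N./2 by lia.
rewrite coef_reflQ coef_divdiffQ.
rewrite [v.2`__]nth_default; last by apply: leq_trans h2 _; lia.
by rewrite /divdiff !rmorph0 subr0 div0p !mulr0 !addr0.
Qed.
End Weight.

(** * Relations satisfied by the half operators *)

Section HalfOp.
Variables (K : fieldType) (c : K) (P0 : {poly K}) (k al : K).
Local Notation V := ({poly {poly K}} * {poly {poly K}})%type.
Hypotheses (k0 : k != 0) (sP0 : refl c P0 = P0).
Local Notation op := (half_op c P0 k al).

Let scE (a : {poly K}) (v : V) : a *: v = (a%:P * v.1, a%:P * v.2).
Proof. by rewrite !mul_polyC. Qed.

Let sC (a : K) : reflQ c a%:P%:P = a%:P%:P.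
Proof. by rewrite reflQC reflC. Qed.

Lemma half_op_zmod_morphism : zmod_morphism op.
Proof.
apply: bi_half_zmod_morphism (center_neq0 c) _ _ _ _ _; exact: divdiffQE.
Qed.

Lemma half_op_scale (a : K) (v : V) : op (a%:P *: v) = a%:P *: op v.
Proof.
rewrite !scE; apply: bi_half_fix (center_neq0 c) _ _ _ _ _ _ _ _.
  exact: divdiffQE.
exact: sC.
Qed.

Lemma half_op_sqr (v : V) :
  op (op v) = (('X + P0%:P) * v.1, ('X + P0%:P) * v.2).
Proof.
apply: (bi_half_sqr (@reflQK _ c) (center_neq0 c) (refl_center c)).
- exact: divdiffQE.
- by rewrite rmorphD /= /reflQ map_polyX map_polyC /= sP0.
- exact: sC.
- exact: sC.
- exact: sC.
- by rewrite -!polyCM mulVf.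
Qed.

Lemma half_op_mulX (v : V) :
  op ('X *: v) = ((2 * c)%:P - 'X) *: op v + (2 * al)%:P *: v.
Proof.
have XE : ('X)%:P = center c + c%:P%:P :> {poly {poly K}}.
  by rewrite /center -polyCD subrK.
have XE' : ((2 * c)%:P - 'X)%:P = c%:P%:P - center c :> {poly {poly K}}.
  by rewrite /center -polyCB polyCM; congr polyC; ring.
have two : (2 * al)%:P%:P = 2 * al%:P%:P :> {poly {poly K}}.
  by rewrite !mulr_natl !rmorphMn.
rewrite !scE XE XE' two.
rewrite [LHS](bi_half_mul (center_neq0 c) (refl_center c)) //; last exact: sC.
exact: divdiffQE.
Qed.

End HalfOp.

(** * The three central expressions for a half sum and a half difference *)

Section HalfSumDifference.
Variables (A : pzRingType) (q x u w a b : A).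
Hypotheses (qC : central q) (q2 : q + q = 1).
Hypotheses (xu : anticomm x u = u + a) (xw : anticomm x w = b - w).

Lemma central_anticommr y z : anticomm y (q * z) = q * anticomm y z.
Proof. by rewrite /anticomm mulrDr !mulrA -(qC y). Qed.

Lemma central_anticomml y z : anticomm (q * y) z = q * anticomm y z.
Proof. by rewrite /anticomm mulrDr !mulrA -(qC z). Qed.

Lemma anticommC (y z : A) : anticomm y z = anticomm z y.
Proof. by rewrite /anticomm addrC. Qed.

Lemma anticommDr (y z t : A) : anticomm y (z + t) = anticomm y z + anticomm y t.
Proof. by rewrite /anticomm mulrDr mulrDl addrACA. Qed.

Lemma anticommNr (y z : A) : anticomm y (- z) = - anticomm y z.
Proof. by rewrite /anticomm mulrN mulNr opprD. Qed.

Lemma bi_kappa_half : bi_kappa x (q * (u + w)) (q * (u - w)) = q * (a + b).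
Proof.
rewrite /bi_kappa central_anticommr anticommDr xu xw -mulrBr; congr (q * _).
by rewrite [b - w]addrC addrACA [LHS]addrAC subrr add0r.
Qed.

Lemma bi_mu_half : bi_mu x (q * (u + w)) (q * (u - w)) = q * (a - b).
Proof.
rewrite /bi_mu anticommC central_anticommr anticommDr anticommNr xu xw -mulrBr.
by congr (q * _); rewrite opprB addrACA [LHS]addrAC subrr add0r.
Qed.

(** The mixed terms in the anticommutator of [u + w] and [u - w] cancel, leaving twice
    [u * u - w * w]; one factor [q] absorbs the 2. *)
Lemma bi_lambda_half :
  bi_lambda x (q * (u + w)) (q * (u - w)) = q * (u * u - w * w) - x.
Proof.
rewrite /bi_lambda central_anticomml central_anticommr; congr (_ - _).
rewrite anticommDr anticommNr [anticomm _ u]anticommC [anticomm _ w]anticommC.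
rewrite !anticommDr [anticomm w u]anticommC opprD addrACA.
rewrite [_ - anticomm w w]addrC addrACA.
rewrite addNr addr0 /anticomm opprD addrACA.
by set t := u * u - w * w; rewrite (mulrDr q t t) -mulrDl q2 mul1r.
Qed.
End HalfSumDifference.

(** * The operators of the model and their relations *)

Section Model.
Variables (K : fieldType) (kap lam mu h : K).
Hypotheses (two0 : 2 != 0 :> K) (hp0 : h + 1 != 0) (hm0 : h - 1 != 0).
Local Notation V := ({poly {poly K}} * {poly {poly K}})%type.
Local Notation A := (endo (@polyC K) V).
Local Notation cst := (@endo_const K _ (@polyC K) V).

Definition half_endo c P0 k al : A :=
  Endo (@half_op_zmod_morphism K c P0 k al) (@half_op_scale K c P0 k al).

Definition endo_X : A.
refine (@Endo K _ (@polyC K) V (fun v => 'X *: v) _ _).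
- by move=> u v; rewrite scalerBr.
- by move=> k v; rewrite !scalerA mulrC.
Defined.

(** [polU] is invariant under X -> 1 - X and [polW] under X -> -1 - X, as the squares require; their
    difference is 2 X + 2 [lam]. *)
Definition polU : {poly K} := - 'X^2 + 'X + lam%:P.
Definition polW : {poly K} := - 'X^2 - 'X - lam%:P.
(** The fixed points 1/2 and -1/2 give the reflections X -> 1 - X and X -> -1 - X. The last argument
    is halved because [half_op_mulX] doubles it. *)
Definition endo_U := half_endo 2^-1 polU (h + 1) ((kap + mu) / 2).
Definition endo_W := half_endo (- 2^-1) polW (h - 1) ((kap - mu) / 2).
Definition endo_Y : A := cst 2^-1 * (endo_U + endo_W).
Definition endo_Z : A := cst 2^-1 * (endo_U - endo_W).

Lemma anticomm_XU : anticomm endo_X endo_U = endo_U + cst (kap + mu).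
Proof.
apply: endoP => v; rewrite /anticomm !endoDE !endoME /= half_op_mulX.
rewrite divff // mulrCA divff // mulr1 scalerBl scale1r.
by rewrite addrA [X in X + _]addrC subrK.
Qed.

Lemma anticomm_XW : anticomm endo_X endo_W = cst (kap - mu) - endo_W.
Proof.
apply: endoP => v; rewrite /anticomm !endoDE !endoME endoNE /= half_op_mulX.
rewrite mulrN divff // mulrCA divff // mulr1 scalerBl polyCN scaleN1r.
by rewrite addrA [X in X + _]addrC subrK addrC.
Qed.

Let refl_half (P : {poly K}) :
  (refl 2^-1 P = P \Po (1 - 'X)) * (refl (- 2^-1) P = P \Po (-1 - 'X)).
Proof. by rewrite /refl mulrN divff // polyCN. Qed.

Lemma endo_UW :
  endo_U * endo_U - endo_W * endo_W = cst (2 * lam) + cst 2 * endo_X.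
Proof.
apply: endoP => v; rewrite !endoDE endoNE !endoME /=.
have rC a q : (a%:P : {poly K}) \Po q = a%:P by exact: comp_polyC.
rewrite !half_op_sqr //; first last.
- rewrite refl_half /polU !(rmorphD, rmorphN, rmorphXn) /=.
  by rewrite !comp_polyX rC; ring.
- rewrite refl_half /polW !(rmorphB, rmorphN, rmorphXn) /=.
  by rewrite !comp_polyX rC; ring.
rewrite scalerA -scalerDl [RHS]surjective_pairing /= -!mul_polyC.
transitivity ((polU - polW)%:P * v.1, (polU - polW)%:P * v.2).
  rewrite (polyCB polU polW) -[LHS]/(_ - _, _ - _) /=; congr pair; ring.
have -> : polU - polW = (2 * lam)%:P + 2%:P * 'X.
  by rewrite /polU /polW polyCM polyC_natr; ring.
by [].
Qed.

Let q2 : cst 2^-1 + cst 2^-1 = 1.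
Proof.
apply: endoP => v; rewrite endoDE /= -scalerDl -polyCD.
have -> : 2^-1 + 2^-1 = 1 :> K by field.
exact: scale1r.
Qed.

Let half_cst a b : (a = 2 * b) -> cst 2^-1 * cst a = cst b.
Proof.
by move=> ->; apply: endoP => v; rewrite endoME /= scalerA -polyCM mulKf.
Qed.

Let cstD a b : cst a + cst b = cst (a + b).
Proof. by apply: endoP => v; rewrite endoDE /= polyCD scalerDl. Qed.

Let cstB a b : cst a - cst b = cst (a - b).
Proof. by apply: endoP => v; rewrite endoDE endoNE /= polyCB scalerBl. Qed.

Lemma model_kappa : bi_kappa endo_X endo_Y endo_Z = cst kap.
Proof.
rewrite (bi_kappa_half (@endo_const_central _ _ _ _ _) anticomm_XU anticomm_XW).
by rewrite cstD; apply: half_cst; ring.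
Qed.

Lemma model_mu : bi_mu endo_X endo_Y endo_Z = cst mu.
Proof.
rewrite (bi_mu_half (@endo_const_central _ _ _ _ _) anticomm_XU anticomm_XW).
by rewrite cstB; apply: half_cst; ring.
Qed.

Lemma model_lambda : bi_lambda endo_X endo_Y endo_Z = cst lam.
Proof.
rewrite (bi_lambda_half _ _ _ (@endo_const_central _ _ _ _ _) q2) endo_UW.
rewrite mulrDr mulrA.
rewrite (@half_cst 2 1) ?mulr1 // (half_cst (erefl _)).
have -> : cst 1 = 1 by apply: endoP => v; exact: scale1r.
by rewrite mul1r addrK.
Qed.

Let hh : h ^+ 2 - 1 = (h + 1) * (h - 1).
Proof. ring. Qed.

(** The half sum and half difference of [h + 1] and [h - 1] are [h] and 1; those of their inverses
    are [h / (h ^+ 2 - 1)] and [- (h ^+ 2 - 1)^-1]. Hence at either parity the factors of [Y] and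
    [Z] differ by [h] up to sign. *)
Lemma symbol_endo_YZ N (v : V) t : weight_le N v -> symbol N v = t%:P ->
  [/\ weight_le N.+1 (endo_Y v), weight_le N.+1 (endo_Z v),
    symbol N.+1 (endo_Y v) = ((if odd N then h / (h ^+ 2 - 1) else h) * t)%:P &
    symbol N.+1 (endo_Z v) = ((if odd N then - (h ^+ 2 - 1)^-1 else 1) * t)%:P].
Proof.
have YE : endo_Y v = (2^-1)%:P *: (endo_U v + endo_W v) by [].
have ZE : endo_Z v = (2^-1)%:P *: (endo_U v - endo_W v) by [].
move=> wv sv.
have [wU sU] := half_op_weight 2^-1 polU (h + 1) ((kap + mu) / 2) wv.
have [wW sW] := half_op_weight (- 2^-1) polW (h - 1) ((kap - mu) / 2) wv.
rewrite sv !reflC -!polyCM in sU sW.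
have wN : weight_le N.+1 (- (endo_W v)) by rewrite -scaleN1r; exact: weight_leZ.
split.
- by rewrite YE; apply: weight_leZ; exact: weight_leD.
- by rewrite ZE; apply: weight_leZ; exact: weight_leD.
- rewrite YE symbolZ raddfD /= sU sW -polyCD -polyCM; congr polyC.
  by case: ifP => _; [rewrite hh; field; rewrite two0 hp0 hm0 | field].
- rewrite ZE symbolZ raddfB /= sU sW -polyCB -polyCM; congr polyC.
  by case: ifP => _; [rewrite hh; field; rewrite two0 hp0 hm0 | field].
Qed.
End Model.

(** * Independence *)

Section Words.
Variables (K : fieldType) (kap lam mu h : K).
Hypotheses (two0 : 2 != 0 :> K) (hp0 : h + 1 != 0) (hm0 : h - 1 != 0).
Local Notation V := ({poly {poly K}} * {poly {poly K}})%type.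
Local Notation cst := (@endo_const K _ (@polyC K) V).
Local Notation X := (endo_X K).
Local Notation Y := (endo_Y kap lam mu h).
Local Notation Z := (endo_Z kap lam mu h).

Definition word_weight N : K :=
  \prod_(n < N) (if odd n then (h ^+ 2 - 1)^-1 else 1).
Definition word_sign k : K := \prod_(n < k) (-1) ^+ n.

Lemma word_weight_neq0 N : word_weight N != 0.
Proof.
apply/prodf_neq0 => i _; case: ifP => _; last exact: oner_neq0.
rewrite invr_eq0 [a in a != 0](_ : _ = (h + 1) * (h - 1)) ?mulf_neq0 //; ring.
Qed.

(** The symbol stays constant in X, so reflections fix it. The letter acting at weight [n]
    contributes the [n]-th factor of [word_weight]; [Y] adds a factor [h], and [Z], which acts first
    at weights below [k], adds the sign [(-1) ^+ n]. *)
Lemma symbol_YZ b k (v := (Y ^+ b * Z ^+ k) ((1, 0) : V)) :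
  weight_le (b + k) v /\
  symbol (b + k) v = (h ^+ b * word_weight (b + k) * word_sign k)%:P.
Proof.
rewrite {}/v; elim: b => [|b [wb sb]].
  rewrite mul1r add0n; elim: k => [|k [wk sk]].
    rewrite /word_weight /word_sign !big_ord0 !mulr1; split=> //.
    by split; rewrite /= ?size_poly1 ?size_poly0.
    by rewrite /symbol /= coefC.
  rewrite exprS endoME.
  have [_ wZ _ sZ] := symbol_endo_YZ kap lam mu two0 hp0 hm0 wk sk.
  split=> //; rewrite [LHS]sZ /word_weight /word_sign !big_ord_recr /=.
  rewrite -signr_odd; congr polyC; case: (odd _) => /=; ring.
rewrite exprS -mulrA endoME.
have [wY _ sY _] := symbol_endo_YZ kap lam mu two0 hp0 hm0 wb sb.
split=> //; rewrite [LHS]sY /word_weight addSn !big_ord_recr /= (exprS h b).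
congr polyC; case: (odd _) => /=; ring.
Qed.

Lemma endo_XE i (v : V) : (X ^+ i) v = 'X^i *: v.
Proof.
elim: i => [|i IHi]; first by rewrite scale1r.
by rewrite exprS endoME IHi /= scalerA -exprS.
Qed.

Lemma model_monomial i b k r s t :
  (X ^+ i * Y ^+ b * Z ^+ k * cst kap ^+ r * cst lam ^+ s * cst mu ^+ t)
    ((1, 0) : V)
  = (kap ^+ r * lam ^+ s * mu ^+ t)%:P *: ('X^i *: (Y ^+ b * Z ^+ k) (1, 0)).
Proof.
set w := X ^+ i * Y ^+ b * Z ^+ k.
have wE : w ((1, 0) : V) = 'X^i *: (Y ^+ b * Z ^+ k) (1, 0).
  by rewrite /w -mulrA [LHS]endoME endo_XE.
rewrite -wE -(endo_scale w) -[w * _ * _]mulrA -[w * _ * _]mulrA [LHS]endoME.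
congr (endo_fun w _).
by rewrite !endoME !endo_constX !scalerA !rmorphM.
Qed.

Lemma symbol_monomial N i b k r s t : (b + k <= N)%N ->
  symbol N
    ((X ^+ i * Y ^+ b * Z ^+ k * cst kap ^+ r * cst lam ^+ s * cst mu ^+ t)
      ((1, 0) : V)) =
  if N == (b + k)%N then
    (kap ^+ r * lam ^+ s * mu ^+ t * h ^+ b * word_sign k * word_weight N)%:P
      * 'X^i
  else 0.
Proof.
move=> bkN; rewrite model_monomial !symbolZ; have [wt sy] := symbol_YZ b k.
case: eqP => [->|/eqP Nbk]; last first.
  by rewrite (symbol_gt wt) ?mulr0 // ltn_neqAle eq_sym Nbk.
by rewrite sy mulrCA mulrC -polyCM; congr (_%:P * _); ring.
Qed.
End Words.

Definition YZ_degree (n : index) : nat :=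
  let: (i, j, k, r, s, t) := n in (j + k)%N.

Local Notation BI_monomial F := (bi_monomial (BI_X F) (BI_Y F) (BI_Z F)).

Lemma BI_lrmorphism (F : fieldType) (A : algType F) (x y z : A) :
  central (bi_kappa x y z) -> central (bi_lambda x y z) ->
  central (bi_mu x y z) ->
  exists f : {lrmorphism BI F -> A},
    forall n, f (BI_monomial F n) = bi_monomial x y z n.
Proof.
move=> ck cl cm; have [f [flin fmon fX fY fZ]] := BI_universal ck cl cm.
pose g : {lrmorphism BI F -> A} :=
  HB.pack f (GRing.isLinear.Build F (BI F) A *:%R f flin)
    (GRing.isMonoidMorphism.Build (BI F) A f fmon).
exists g => [[[[[[i j] k] r] s] t]]; rewrite !rmorphM !rmorphXn.
by rewrite rmorph_bi_kappa rmorph_bi_lambda rmorph_bi_mu /= fX fY fZ.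
Qed.

(** * Independence, given four algebraically independent parameters *)

Section Independence.
Variables (F K : fieldType) (j : {rmorphism F -> K}) (kap lam mu h : K).
Hypotheses (two0 : 2 != 0 :> K) (hp0 : h + 1 != 0) (hm0 : h - 1 != 0).

Let mon (q : nat * nat * nat * nat) : K :=
  let: (r, s, t, b) := q in kap ^+ r * lam ^+ s * mu ^+ t * h ^+ b.

(** Different indices may share the same four exponents, so the conclusion concerns the coefficient
    sum over each fibre of [e]. *)
Hypothesis mon_independent :
  forall (I : eqType) (s : seq I) (c : I -> F) (e : I -> nat * nat * nat * nat),
  \sum_(n <- s) j (c n) * mon (e n) = 0 ->
  forall q, \sum_(n <- s | e n == q) c n = 0.

Local Notation V := ({poly {poly K}} * {poly {poly K}})%type.
Local Notation A := (endo_restr (@polyC K) V j).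

Local Notation X := (endo_X K).
Local Notation Y := (endo_Y kap lam mu h).
Local Notation Z := (endo_Z kap lam mu h).
Local Notation cst := (@endo_const K _ (@polyC K) V).

Lemma BI_model : exists f : {lrmorphism BI F -> A}, forall i b k r s t,
  f (BI_monomial F (i, b, k, r, s, t)) =
  X ^+ i * Y ^+ b * Z ^+ k * cst kap ^+ r * cst lam ^+ s * cst mu ^+ t.
Proof.
have k := model_kappa kap lam mu h two0.
have l := model_lambda kap lam mu two0 hp0 hm0.
have m := model_mu kap lam mu h two0.
have [|||f fE] := @BI_lrmorphism F A X Y Z.
- by rewrite [X in central X]k; exact: endo_const_central.
- by rewrite [X in central X]l; exact: endo_const_central.
- by rewrite [X in central X]m; exact: endo_const_central.
by exists f => i b k' r s t; rewrite fE -k -l -m.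
Qed.

Lemma BI_monomials_independent : lin_independent (BI_monomial F).
Proof.
have [f fE] := BI_model.
move=> s c us sum0.
have {}sum0 N : \sum_(n <- s) (j (c n))%:P *
    symbol N (f (BI_monomial F n) ((1, 0) : V)) = 0.
  pose phi u := symbol N (f u ((1, 0) : V)).
  have phiD u v : phi (u + v) = phi u + phi v.
    by rewrite /phi raddfD -[RHS]raddfD.
  have phi0 : phi 0 = 0 by rewrite /phi raddf0 [LHS]raddf0.
  rewrite -[RHS]phi0 -sum0 (big_morph phi phiD phi0); apply: eq_bigr => n _.
  by rewrite /phi linearZ -symbolZ.
pose bound := (\max_(n <- s) YZ_degree n).+1.
(* Descending induction on the degree in [Y] and [Z]: [bound] exceeds every degree occurring in [s],
   so [m = 0] is vacuous. *)
suff main m n : n \in s -> (bound <= YZ_degree n + m)%N -> c n = 0.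
  by move=> n ns; apply: (main bound n) => //; exact: leq_addl.
elim: m n => [|m IHm] n0 n0s.
  rewrite addn0 /bound ltnNge => /negP[]; exact: leq_bigmax_seq.
move=> bn0; case E : n0 => [[[[[i0 j0] k0] r0] s0] t0].
have deg_le n : n \in s -> (YZ_degree n <= YZ_degree n0)%N \/ c n = 0.
  move=> ns; case: leqP => [|lt]; [by left | right].
  by apply: IHm => //; apply: leq_trans bn0 _; rewrite addnS -addSn leq_add2r.
pose N := YZ_degree n0.
(* The signs are formed in [F] so that they can join the coefficients, which [mon_independent] takes
   from [F]. *)
pose sgn k : F := \prod_(n < k) (-1) ^+ n.
have sgnE k : j (sgn k) = word_sign _ k.
  rewrite /sgn /word_sign rmorph_prod; apply: eq_bigr => i _.
  by rewrite rmorphXn rmorphN rmorph1.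
pose e (n : index) := let: (i, b, k, r, s, t) := n in (r, s, t, b).
(* Only monomials of degree [N] in [Y], [Z] and of degree [i0] in [X] reach the coefficient under
   study; all others receive 0. *)
pose c' (n : index) : F := let: (i, b, k, r, s, t) := n in
  if (N == b + k)%N && (i == i0) then c n * sgn k else 0.
have : \sum_(n <- s) j (c' n) * mon (e n) = 0.
  (* Take the coefficient of X^i0 in the symbol of weight [N] and divide by the factor common to all
     monomials of degree [N]. *)
  have := congr1 (fun p : {poly K} => (p`_i0) / word_weight h N) (sum0 N).
  rewrite coef0 mul0r coef_sum mulr_suml; apply: etrans.
  apply: eq_big_seq => n ns.
  have [le_n|cn0] := deg_le n ns; last first.
    rewrite cn0 rmorph0 mul0r coef0 mul0r.
    move: cn0; rewrite /c'; case: n {ns} => [[[[[i b] k] r] s1] t] ->.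
    by rewrite mul0r if_same rmorph0 mul0r.
  move: le_n; rewrite /c' /mon /e; case: n {ns} => [[[[[i b] k] r] s1] t] le_n.
  rewrite [f _]fE.
  rewrite [symbol _ _](symbol_monomial _ _ _ two0 hp0 hm0) //.
  case: eqP => _ /=; last by rewrite rmorph0 mulr0 coef0 !mul0r.
  rewrite !coefCM coefXn [i0 == i]eq_sym.
  case: eqP => _; last by rewrite rmorph0 mulr0n !mulr0 !mul0r.
  rewrite mulr1n mulr1 rmorphM /= sgnE !mulrA mulfK ?word_weight_neq0 //; ring.
(* Among the indices kept by [c'], the exponent [b] determines [k] through [b + k = N], so [n0] is
   the only one in its fibre. *)
move/mon_independent/(_ (e n0)); rewrite big_mkcond (bigD1_seq n0) //= eqxx.
rewrite big1 ?addr0 => [|n nn0]; last first.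
  case: eqP => //; move: nn0; rewrite /c' /e /N E.
  case: n => [[[[[i b] k] r] s1] t] /= neq [er es et eb].
  case: eqP => //= dk; case: eqP => // ei; move: neq dk.
  by rewrite er es et eb ei => neq /addnI dk; rewrite dk eqxx in neq.
rewrite /c' /N E /= !eqxx /= => /eqP; rewrite mulf_eq0 => /orP[/eqP //|].
rewrite prodf_seq_eq0 => /hasP[i _] /=.
by rewrite expf_eq0 oppr_eq0 oner_eq0 andbF.
Qed.
End Independence.

(** * A field with four independent variables over [F] *)

Section FourVariables.
Variable F : fieldType.
Local Notation R := {poly {poly {poly {poly F}}}}.

(** From the outermost variable to the innermost, the variables stand for kappa, lambda, mu and
    [h]. *)
Definition mono4 (c : F) (r s t b : nat) : R :=
  'X^r * ('X^s * ('X^t * ('X^b * c%:P)%:P)%:P)%:P.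

Lemma coef_XnC (S : comNzRingType) (a : S) n m :
  ('X^n * a%:P)`_m = a *+ (m == n).
Proof. by rewrite mulrC coefCM coefXn mulr_natr. Qed.

Lemma coef_mono4 c r s t b r' s' t' b' :
  (mono4 c r s t b)`_r'`_s'`_t'`_b' =
    c *+ [&& r' == r, s' == s, t' == t & b' == b].
Proof.
rewrite coef_XnC; case: (r' == r); last by rewrite !mulr0n !coef0.
rewrite mulr1n coef_XnC; case: (s' == s); last by rewrite !mulr0n !coef0.
rewrite mulr1n coef_XnC; case: (t' == t); last by rewrite !mulr0n !coef0.
by rewrite mulr1n coef_XnC.
Qed.

Local Notation K := {fraction R}.
Local Notation tofrac := (@FracField.tofrac R).

Definition frac_const : F -> K := tofrac \o polyC \o polyC \o polyC \o polyC.
HB.instance Definition _ := GRing.RMorphism.on frac_const.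

Definition frac_kap : K := tofrac 'X.
Definition frac_lam : K := tofrac 'X%:P.
Definition frac_mu : K := tofrac 'X%:P%:P.
Definition frac_h : K := tofrac 'X%:P%:P%:P.

Lemma tofrac_mono4 c r s t b : tofrac (mono4 c r s t b) =
  frac_const c * (frac_kap ^+ r * frac_lam ^+ s * frac_mu ^+ t * frac_h ^+ b).
Proof.
have -> : mono4 c r s t b = c%:P%:P%:P%:P *
    ('X ^+ r * 'X%:P ^+ s * 'X%:P%:P ^+ t * 'X%:P%:P%:P ^+ b).
  by rewrite /mono4 !polyCM !polyC_exp; ring.
by rewrite (rmorphM tofrac) !(rmorphM tofrac) !(rmorphXn tofrac).
Qed.

Lemma frac_monomials_independent (I : eqType) (s : seq I) (c : I -> F)
    (e : I -> nat * nat * nat * nat) :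
  \sum_(n <- s) frac_const (c n) * (let: (r, s, t, b) := e n in
    frac_kap ^+ r * frac_lam ^+ s * frac_mu ^+ t * frac_h ^+ b) = 0 ->
  forall q, \sum_(n <- s | e n == q) c n = 0.
Proof.
move=> sum0 [[[r s1] t] b].
pose M n := let: (r, s, t, b) := e n in mono4 (c n) r s t b.
have {sum0} : \sum_(n <- s) M n = 0.
  apply/eqP; rewrite -tofrac_eq0 rmorph_sum; apply/eqP; apply: etrans sum0.
  apply: eq_bigr => n _; rewrite /M; case: (e n) => [[[r' s'] t'] b'].
  exact: tofrac_mono4.
(* The right-hand 0 is replaced by the coefficient at [(r, s1, t, b)], after which the two sums
   agree term by term. *)
move/(congr1 (fun p : R => p`_r`_s1`_t`_b)); rewrite !coef0 !coef_sum => {2}<-.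
rewrite big_mkcond; apply: eq_bigr => n _; rewrite /M.
case: (e n) => [[[r' s'] t'] b']; rewrite coef_mono4 !xpair_eqE -!andbA.
rewrite ![_ == r']eq_sym ![_ == s']eq_sym ![_ == t']eq_sym ![_ == b']eq_sym.
by case: ifP.
Qed.

Lemma frac_two_neq0 : 2%N \notin [pchar F] -> (2 : K) != 0.
Proof.
move=> hF; have -> : 2 = frac_const 2 by rewrite rmorph_nat.
by rewrite fmorph_eq0; move: hF; rewrite inE.
Qed.

(** The values -1 and 1 of [a] show that [h + 1] and [h - 1] are invertible. *)
Lemma frac_h_neq0 (a : F) : frac_h - frac_const a != 0.
Proof.
rewrite /frac_h /frac_const /= -rmorphB tofrac_eq0 -!polyCB.
by rewrite !polyC_eq0 polyXsubC_eq0.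
Qed.

End FourVariables.

Lemma BI_independent (F : fieldType) : 2%N \notin [pchar F] ->
  lin_independent (BI_monomial F).
Proof.
move=> hF; apply: (@BI_monomials_independent _ _ (@frac_const F)).
- exact: frac_two_neq0 hF.
- by have := frac_h_neq0 (- 1 : F); rewrite rmorphN rmorph1 opprK; apply.
- by have := frac_h_neq0 (1 : F); rewrite rmorph1; apply.
- exact: frac_monomials_independent.
Qed.

Theorem theorem3p4 (F : fieldType) (hF : 2%N \notin [pchar F]) :
  is_basis (V := BI F)
    (fun n : nat * nat * nat * nat * nat * nat =>
       let: (i, j, k, r, s, t) := n in
       BI_X F ^+ i * BI_Y F ^+ j * BI_Z F ^+ k
         * BI_kappa F ^+ r * BI_lambda F ^+ s * BI_mu F ^+ t).
Proof.
split; last exact: BI_independent hF.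
by move=> v; apply: in_mono_spanP (BI_monomials_span v).
Qed.
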